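(* Let $\mathcal P=\left(\{\,\{o\}\to\{o\to c\}\,\}^{r}\right)_{<5}$ be the class of those maps in $\{\,\{o\}\to\{o\to c\}\,\}^{r}$ whose source and target are spaces with fewer than $5$ points. A Hausdorff space $K$ is compact if and only if the map $K\to\{\bullet\}$ belongs to $\mathcal P^{lr}$. Moreover, the class $\mathcal P^{lr}$ is contained in the class of proper maps.
   Context: All maps are continuous; classes are computed in the category of all topological spaces. $\{\bullet\}$ is the one-point space. $\{o\to c\}$ is the Sierpinski space with open point $o$ and closed point $c$, and $\{o\}\to\{o\to c\}$ is the inclusion of the open point. For maps $f:A\to B$, $g:X\to Y$, $f\pitchfork g$ means: for all $t:A\to X$, $s:B\to Y$ with $g\circ t=s\circ f$ there is $h:B\to X$ with $h\circ f=t$ and $g\circ h=s$. For a class $P$ of maps, $P^l=\{f:\ f\pitchfork g \text{ for all } g\in P\}$, $P^r=\{g:\ f\pitchfork g\text{ for all } f\in P\}$, $P^{lr}=(P^l)^r$. Proper means proper in the sense of Bourbaki: $f:X\to Y$ is proper if it is continuous and $f\times\mathrm{id}_Z:X\times Z\to Y\times Z$ is closed for every topological space $Z$. *)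

(* Defs.v *)
(* A space is a [topologicalType] (possibly empty)
   and a map is a [continuousType], i.e. a continuous function. *)
From HB Require Import structures.
From mathcomp Require Import all_boot.
From mathcomp Require Import all_classical.
From mathcomp Require Import topology.

Set Implicit Arguments.
Unset Strict Implicit.
Unset Printing Implicit Defensive.

Local Open Scope classical_set_scope.

Definition map_class :=
  forall X Y : topologicalType, continuousType X Y -> Prop.

(* The relation f \pitchfork g. *)
Definition lifts (A B X Y : topologicalType)
    (f : continuousType A B) (g : continuousType X Y) : Prop :=
  forall (t : continuousType A X) (s : continuousType B Y),
    g \o t =1 s \o f ->
    exists h : continuousType B X, h \o f =1 t /\ g \o h =1 s.

Definition left_orth (P : map_class) : map_class := fun A B f =>
  forall (X Y : topologicalType) (g : continuousType X Y), P X Y g -> lifts f g.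

Definition right_orth (P : map_class) : map_class := fun X Y g =>
  forall (A B : topologicalType) (f : continuousType A B), P A B f -> lifts f g.

(* The class {f}. It is an indexed family because its members have varying
   source and target. *)
Variant singleton_class (A B : topologicalType) (f : continuousType A B) :
    forall X Y : topologicalType, continuousType X Y -> Prop :=
  | Singleton_class : singleton_class f f.

Definition fewer_points (n : nat) (X : topologicalType) : Prop :=
  exists2 k, (k < n)%N & ([set: X] #= `I_k)%card.

(* P_{<n} *)
Definition restrict_lt (n : nat) (P : map_class) : map_class := fun X Y f =>
  [/\ P X Y f, fewer_points n X & fewer_points n Y].

Variant sierpinski := open_pt | closed_pt.

HB.instance Definition _ := gen_eqMixin sierpinski.
HB.instance Definition _ := gen_choiceMixin sierpinski.

Definition sierpinski_open (U : set sierpinski) : Prop :=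
  U closed_pt -> U open_pt.

Lemma sierpinski_openT : sierpinski_open setT.
Proof. by []. Qed.

Lemma sierpinski_openI : setI_closed sierpinski_open.
Proof. by move=> U V oU oV [/oU ? /oV ?]. Qed.

Lemma sierpinski_open_bigU (I : Type) (f : I -> set sierpinski) :
  (forall i, sierpinski_open (f i)) -> sierpinski_open (\bigcup_i f i).
Proof. by move=> of_ [i _ /of_ ?]; exists i. Qed.

HB.instance Definition _ := isOpenTopological.Build sierpinski
  sierpinski_openT sierpinski_openI sierpinski_open_bigU.

Definition one_point : topologicalType := discrete_topology unit.

(* {o} -> {o -> c} *)
Definition open_pt_incl : continuousType one_point sierpinski := cst open_pt.

Definition to_point (X : topologicalType) : continuousType X one_point :=
  cst (tt : one_point).

Definition proper_map (X Y : topologicalType) (f : continuousType X Y) : Prop :=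
  forall (Z : topologicalType) (C : set (X * Z)%type), closed C ->
    closed ((fun p : X * Z => (f p.1, p.2)) @` C).

Definition calP : map_class :=
  restrict_lt 5 (right_orth (singleton_class open_pt_incl)).

Definition calP_lr : map_class := right_orth (left_orth calP).

(* Main.v *)
(* The inclusion of a discrete set X into X plus one point "at infinity" whose
   neighbourhoods trace an ultrafilter on X lies in P^l, because an ultrafilter
   pushed forward to a finite space is principal.  Lifting against these
   inclusions says that every limit of f(U), for U an ultrafilter, is the image
   of a limit of U, so maps in P^lr are proper.  Conversely, P contains
   {c} -> {o -> c} and {a <- u -> b} -> {*}; lifting against them shows that a
   map A -> B in P^l has dense image and that the images of disjoint closed sets
   have disjoint closures.  By Taimanov's theorem every map from A to a compact
   Hausdorff space then extends to B. *)
Require Import Defs.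
From HB Require Import structures.
From mathcomp Require Import all_boot.
From mathcomp Require Import all_classical.
From mathcomp Require Import topology.

Set Implicit Arguments.
Unset Strict Implicit.
Unset Printing Implicit Defensive.

Local Open Scope classical_set_scope.

(** * Ultrafilters and maps to finite sets *)

Lemma fmap_ultra (T U : Type) (f : T -> U) (F : set_system T) :
  UltraFilter F -> UltraFilter (fmap f F).
Proof.
move=> FU; split=> [|G GP FG]; first exact: fmap_proper_filter.
rewrite eqEsubset; split=> // A GA.
have [//|FnA] := in_ultra_setVsetC (f @^-1` A) FU.
have GnA : G (~` A) by exact: FG.
by have [? []] := filter_ex (filterI GA GnA).
Qed.

(** Induction on an enumeration of [U]: an ultrafilter contains the fibre over the head of the list
    or its complement, and in the latter case the preimage of the tail. *)
Lemma ultra_finite_fiber (T : Type) (U : eqType) (t : T -> U)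
    (F : set_system T) :
  UltraFilter F -> finite_set [set: U] -> exists u, F (t @^-1` [set u]).
Proof.
move=> FU /finite_seqP[s sE].
have : F (t @^-1` [set` s]) by rewrite -sE; exact: filterT.
elim: s {sE} => [|u s IH] Fs.
  by have [x /=] := filter_ex Fs; rewrite in_nil.
have [Fu|Fu] := in_ultra_setVsetC (t @^-1` [set u]) FU; first by exists u.
apply: IH; apply: filterS (filterI Fs Fu) => x [/=].
by rewrite in_cons => /orP[/eqP|].
Qed.

(** * Taimanov's extension theorem *)

(** The value [h b] is the limit of the filter [G b] of [t]-images of traces on [A] of
    neighbourhoods of [b]. Density makes [G b] proper, compactness gives it a cluster point, and
    separation turns this point into a limit. *)
Lemma Taimanov_extension (A B K : topologicalType) (f : A -> B) (t : A -> K) :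
  hausdorff_space K -> compact [set: K] -> continuous t ->
  closure (range f) = setT ->
  (forall F1 F2 : set A, closed F1 -> closed F2 -> F1 `&` F2 = set0 ->
    closure (f @` F1) `&` closure (f @` F2) = set0) ->
  exists2 h : B -> K, continuous h & h \o f =1 t.
Proof.
move=> hK cK ct df sep.
have regK (x : K) : {for x, regular_space K}.
  by apply: compact_regular cK _ => //; exact: filterT.
pose G (b : B) := filter_from (nbhs b) (fun U => t @` (f @^-1` U)).
have ex_nbhs (b : B) (U : set B) : nbhs b U -> exists a, U (f a).
  move=> bU; have : closure (range f) b by rewrite df.
  by move=> /(_ _ bU) [_ [[a _ <-] Ufa]]; exists a.
have GP b : ProperFilter (G b).
  apply: filter_from_proper => [|U /ex_nbhs[a Ua]]; last by exists (t a), a.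
  apply: filter_from_filter; first by exists setT; exact: filterT.
  move=> U V bU bV; exists (U `&` V); first exact: filterI.
  by move=> _ [a [Ua Va] <-]; split; exists a.
have exh (b : B) : exists x : K, G b --> x.
  have [x [_ Gx]] : [set: K] `&` cluster (G b) !=set0.
    by apply: cK; exact: filterT.
  exists x => V; rewrite /= => xV.
  (* The preimages of [closure W] and of the complement of the interior of [V] are disjoint closed
     sets. As [x] is a cluster point, [b] is in the closure of the image of the first, hence some
     neighbourhood of [b] misses the image of the second. *)
  have [W xW WV] := regK _ _ (nbhs_interior xV).
  have disj : t @^-1` (closure W) `&` t @^-1` (~` V°) = set0.
    by rewrite -preimage_setI -subset0 => a [/WV ? ?].
  have : ~ closure (f @` (t @^-1` (~` V°))) b.
    move=> bV; suff : set0 b by [].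
    rewrite -(sep _ _ _ _ disj).
    - split=> // U bU.
      have [_ [[a Ua <-] Wta]] : (t @` (f @^-1` U)) `&` W !=set0.
        by apply: Gx => //; exists U.
      exists (f a); split=> //; exists a => //; exact: subset_closure.
    - by apply: preimage_closed => //; exact: closed_closure.
    - by apply: preimage_closed => //; exact/open_closedC/open_interior.
  move=> /existsNP[U /not_implyP[bU nU]]; exists U => // _ [a Ua <-].
  apply: contrapT => nVta; apply: nU; exists (f a); split=> //.
  by exists a => // /interior_subset.
have [h hP] := choice exh.
exists h => [b V hbV|a].
  have [W bW WV] := regK (h b) _ hbV.
  have [U bU UW] := hP b _ bW.
  (* For [c] in the interior of [U], density gives a point of [A] over [U] and over any
     neighbourhood of [c], so [h c] lies in [closure W]. *)
  apply: filterS (nbhs_interior bU) => c cU; apply: WV => N cN.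
  have [U' cU' UN] := hP c _ cN.
  have [a [Ua U'a]] := ex_nbhs _ _ (filterI cU cU').
  by exists (t a); split; [apply: UW | apply: UN]; exists a.
apply: hK => V W haV taW; have [U aU UV] := hP _ _ haV.
exists (t a); split; last exact: nbhs_singleton.
by apply: UV; exists a => //; exact: (nbhs_singleton aU).
Qed.

(** * Specialization of points and lifting against [open_pt_incl] *)

(** Continuous maps from [sierpinski] to [Y] amount to pairs of points with [y1] in the closure of
    [y0]. *)
Definition specialization_map (Y : Type) (y0 y1 : Y) (p : sierpinski) : Y :=
  if p is open_pt then y0 else y1.

Lemma open_sierpinskiE (U : set sierpinski) : open U = sierpinski_open U.
Proof. by []. Qed.

Lemma specialization_map_continuous (Y : topologicalType) (y0 y1 : Y) :
  closure [set y0] y1 -> continuous (specialization_map y0 y1).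
Proof.
move=> y01; apply/continuousP => U oU; rewrite open_sierpinskiE => Uy1.
by have [_ [-> ?]] := y01 U (open_nbhs_nbhs (conj oU Uy1)).
Qed.

Lemma sierpinski_specializes : closure [set open_pt] closed_pt.
Proof.
move=> U; rewrite nbhsE => -[V [oV Vc] VU].
by exists open_pt; split=> //; apply/VU/oV.
Qed.

Lemma closure_image (X Y : topologicalType) (g : X -> Y) (x x' : X) :
  continuous g -> closure [set x] x' -> closure [set g x] (g x').
Proof.
by move=> cg xx' U /cg /xx'[_ [-> Ugx]]; exists (g x).
Qed.

(* For maps of finite spaces the right-hand side says that [g] is closed. *)
Lemma right_orth_open_pt_inclP (X Y : topologicalType)
    (g : continuousType X Y) :
  right_orth (singleton_class open_pt_incl) g <->
  forall x y, closure [set g x] y -> exists2 x', closure [set x] x' & g x' = y.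
Proof.
split=> [gR x y xy|gS A B _ []].
  have cs := specialization_map_continuous xy.
  have [//|h [ht hs]] := gR _ _ _ (Singleton_class open_pt_incl)
    (cst x : continuousType one_point X) (mkcts cs : continuousType _ Y).
  exists (h closed_pt); last exact: hs.
  rewrite -(ht tt : h open_pt = x).
  by apply: closure_image sierpinski_specializes; exact: cts_fun.
move=> t s gts.
have [|x' xx' gx'] := gS (t tt) (s closed_pt).
  rewrite (gts tt : g (t tt) = s open_pt).
  by apply: closure_image sierpinski_specializes; exact: cts_fun.
have ch := specialization_map_continuous xx'.
exists (mkcts ch : continuousType _ X); split=> [[]//|[|]//=].
exact: gts.
Qed.

(** * Ultrafilter extensions and properness *)

(* [X] as a discrete space with one more point [None], whose neighbourhoods
   trace the filter [F] on [X]. *)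
Definition filter_extension (X : Type) (F : filter_on X) : Type := option X.

Section filter_extension_topology.
Variables (X : Type) (F : filter_on X).
Implicit Types U V : set (filter_extension F).

HB.instance Definition _ := gen_eqMixin (filter_extension F).
HB.instance Definition _ := gen_choiceMixin (filter_extension F).

Definition filter_extension_open U : Prop := U None -> nbhs F (Some @^-1` U).

Lemma filter_extension_openT : filter_extension_open setT.
Proof. by move=> _; exact: filterT. Qed.

Lemma filter_extension_openI : setI_closed filter_extension_open.
Proof. by move=> U V oU oV [/oU FU /oV FV]; exact: filterI. Qed.

Lemma filter_extension_open_bigU (I : Type)
    (f : I -> set (filter_extension F)) :
  (forall i, filter_extension_open (f i)) ->
  filter_extension_open (\bigcup_i f i).
Proof.
by move=> of_ [i _ /of_]; apply: filterS => x fix_; exists i.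
Qed.

HB.instance Definition _ := isOpenTopological.Build (filter_extension F)
  filter_extension_openT filter_extension_openI filter_extension_open_bigU.

Lemma open_filter_extensionE U : open U = filter_extension_open U.
Proof. by []. Qed.

(** Each [Some x] is isolated, so continuity is a condition at [None] only. *)
Lemma filter_extension_continuous (Y : topologicalType)
    (h : filter_extension F -> Y) :
  (fun x => h (Some x)) @ F --> h None -> continuous h.
Proof.
move=> hF; apply/continuousP => U oU; rewrite open_filter_extensionE => UN.
exact/hF/open_nbhs_nbhs.
Qed.

Lemma filter_extension_cvg (Y : topologicalType)
    (h : filter_extension F -> Y) :
  continuous h -> (fun x => h (Some x)) @ F --> h None.
Proof.
move=> ch V /ch; rewrite nbhsE => -[U [oU UN] UV].
by apply: filterS (oU UN) => x; exact: UV.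
Qed.

End filter_extension_topology.

Lemma discrete_continuous (X : choiceType) (Y : topologicalType)
    (f : discrete_topology X -> Y) : continuous f.
Proof. by apply/continuousP => U _; exact: discrete_open. Qed.

Definition filter_extension_incl (X : choiceType) (F : filter_on X) :
    continuousType (discrete_topology X) (filter_extension F) :=
  mkcts (@discrete_continuous X (filter_extension F) Some).

(** Since [Y] is finite, [t] takes a single value [y] on a member of [F]. Then [s None] is in the
    closure of [g y], and a point [y'] over it in the closure of [y] serves as the value of the lift
    at [None]. *)
Lemma left_orth_ultrafilter_extension (X : choiceType) (F : filter_on X) :
  UltraFilter F -> left_orth calP (filter_extension_incl F).
Proof.
move=> FU Y Z g [/right_orth_open_pt_inclP gS [k _ Yk] _] t s gts.
have [y Fy] : exists y, nbhs F (t @^-1` [set y]).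
  by apply: ultra_finite_fiber; exists k.
have [|y' yy' gy'] := gS y (s None).
  move=> V /(filter_extension_cvg (@cts_fun _ _ s)) FV.
  have [x [<- Vx]] := filter_ex (filterI Fy FV).
  by exists (g (t x)); split=> //; rewrite -[g _]/((g \o t) x) gts.
have ch : continuous
    ((fun o => if o is Some x then t x else y') : filter_extension F -> Y).
  apply: filter_extension_continuous => V /yy'[_ [-> Vy]].
  by apply: filterS Fy => x /= ->.
exists (mkcts ch : continuousType _ Y); split=> // -[x|]; last exact: gy'.
exact: gts.
Qed.

(** The top of the square is the identity from discrete [X] to [X], the bottom extends [f] by [y] at
    [None]; continuity of the lift [h] says that the ultrafilter converges to [h None]. *)
Lemma calP_lr_ultra (X Y : topologicalType) (f : continuousType X Y)
    (U : set_system X) (y : Y) :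
  calP_lr f -> UltraFilter U -> f @ U --> y ->
  exists2 x, U --> x & f x = y.
Proof.
move=> fP UU fUy; pose F := FilterType U (@ultra_proper _ _ UU).
have cs : continuous
    ((fun o => if o is Some x then f x else y) : filter_extension F -> Y).
  exact: filter_extension_continuous.
have [//|h [ht hs]] := fP _ _ _ (left_orth_ultrafilter_extension (F := F) UU)
  (mkcts (@discrete_continuous X X id)) (mkcts cs).
exists (h None); last exact: (hs None).
have hid : (fun x => h (Some x)) = id by exact/funext/ht.
by have := filter_extension_cvg (@cts_fun _ _ h); rewrite hid.
Qed.

Lemma calP_lr_proper (X Y : topologicalType) (f : continuousType X Y) :
  calP_lr f -> proper_map f.
Proof.
move=> fP Z C cC [y z] yzC.
set g := (fun p : X * Z => (f p.1, p.2)).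
(* [W] is an ultrafilter on [C] whose image under [g] converges to [(y, z)]. Its projection to [X]
   gets a limit [x] over [y], and [(x, z)] is then in the closure of [C]. *)
have [|W [WU /= CW]] :=
    @ultraFilterLemma _ (filter_from (nbhs (y, z)) (fun N => C `&` g @^-1` N)).
  apply: filter_from_proper => [|N /yzC[_ [[p Cp <-] Np]]]; last by exists p.
  apply: filter_from_filter; first by exists setT; exact: filterT.
  move=> M N yzM yzN; exists (M `&` N); first exact: filterI.
  by move=> p [Cp [Mp Np]].
have gW N : nbhs (y, z) N -> W (C `&` g @^-1` N).
  by move=> yzN; apply: CW; exists N.
have [|x Wx fxy] := calP_lr_ultra (U := fst @ W) (y := y) fP (fmap_ultra _ WU).
  move=> V yV; have WV : W (C `&` g @^-1` (V `*` setT)).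
    by apply: gW; exists (V, setT) => //; split=> //; exact: filterT.
  by apply: (@filterS _ W _ _ _ _ WV) => p [_ []].
exists (x, z); last by rewrite /g /= fxy.
apply: cC => N [[N1 N2] /= [xN1 zN2] N12].
have W2 : W (C `&` g @^-1` (setT `*` N2)).
  by apply: gW; exists (setT, N2) => //; split=> //; exact: filterT.
have W1 : W (fst @^-1` N1) by exact: Wx.
have [p [[Cp [_ N2p]] N1p]] := filter_ex (filterI W2 W1).
by exists p; split=> //; apply: N12.
Qed.

(** * Two small maps in [calP] *)

(* The space {a <- u -> b}: the open point u is [None], the closed points a and
   b are [Some true] and [Some false]. *)
Definition two_closed_points : Type := option bool.

HB.instance Definition _ := gen_eqMixin two_closed_points.
HB.instance Definition _ := gen_choiceMixin two_closed_points.

Definition two_closed_points_open (U : set two_closed_points) : Prop :=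
  forall b, U (Some b) -> U None.

Lemma two_closed_points_openT : two_closed_points_open setT.
Proof. by []. Qed.

Lemma two_closed_points_openI : setI_closed two_closed_points_open.
Proof. by move=> U V oU oV b [/oU ? /oV ?]. Qed.

Lemma two_closed_points_open_bigU (I : Type)
    (f : I -> set two_closed_points) :
  (forall i, two_closed_points_open (f i)) ->
  two_closed_points_open (\bigcup_i f i).
Proof. by move=> of_ b [i _ /of_ ?]; exists i. Qed.

HB.instance Definition _ := isOpenTopological.Build two_closed_points
  two_closed_points_openT two_closed_points_openI two_closed_points_open_bigU.

Lemma open_two_closed_pointsE (U : set two_closed_points) :
  open U = two_closed_points_open U.
Proof. by []. Qed.

Lemma closed_two_closed_points (b : bool) :
  closed [set Some b : two_closed_points].
Proof.
by rewrite -openC open_two_closed_pointsE => c.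
Qed.

Lemma fewer_points_surj (n k : nat) (X : topologicalType) (e : 'I_k -> X) :
  (k < n)%N -> (forall x, exists i, e i = x) -> fewer_points n X.
Proof.
move=> kn e_surj.
have le : ([set: X] #<= `I_k)%card.
  rewrite (card_le_eqr card_II) (_ : [set: X] = range e) ?card_image_le//.
  by apply/seteqP; split=> // x _; have [i <-] := e_surj x; exists i.
have /finite_setP[m Xm] : finite_set [set: X] by apply/finite_set_leP; exists k.
exists m => //; apply: leq_ltn_trans kn.
by rewrite -card_le_II -(card_le_eql Xm).
Qed.

Lemma fewer_points_one_point : fewer_points 5 one_point.
Proof.
apply: (@fewer_points_surj 5 1 one_point (fun=> tt)) => // -[].
by exists ord0.
Qed.

Lemma fewer_points_sierpinski : fewer_points 5 sierpinski.
Proof.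
apply: (@fewer_points_surj 5 2 sierpinski
  (fun i => if i == ord0 then open_pt else closed_pt)) => // -[].
  by exists ord0.
by exists ord_max.
Qed.

Lemma fewer_points_two_closed_points : fewer_points 5 two_closed_points.
Proof.
apply: (@fewer_points_surj 5 3 two_closed_points (fun i : 'I_3 =>
  if val i is i'.+1 then Some (i' == 0%N) else None)) => // -[[]|].
- by exists (@Ordinal 3 1 isT).
- by exists (@Ordinal 3 2 isT).
- by exists ord0.
Qed.

Definition closed_pt_incl : continuousType one_point sierpinski :=
  cst closed_pt.

Lemma calP_closed_pt_incl : calP closed_pt_incl.
Proof.
split; [|exact: fewer_points_one_point|exact: fewer_points_sierpinski].
apply/right_orth_open_pt_inclP => x y xy; exists x; first exact: subset_closure.
case: y xy => // xo.
have oo : open [set open_pt] by rewrite open_sierpinskiE.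
by have [_ [-> ]] := xo _ (open_nbhs_nbhs (conj oo erefl)).
Qed.

Lemma calP_two_closed_points : calP (to_point two_closed_points).
Proof.
split; [|exact: fewer_points_two_closed_points|exact: fewer_points_one_point].
apply/right_orth_open_pt_inclP => x [] _.
by exists x => //; exact: subset_closure.
Qed.

(** * Density and separation for maps in the left orthogonal of [calP] *)

(** The map to [sierpinski] sending exactly [closure (range f)] to [closed_pt] must factor through
    [closed_pt_incl]. *)
Lemma left_orth_calP_dense (A B : topologicalType) (f : continuousType A B) :
  left_orth calP f -> closure (range f) = setT.
Proof.
move=> fP; rewrite -subTset => b _.
have cs : continuous
    (fun b' => if `[< closure (range f) b' >] then closed_pt else open_pt).
  (* The closed sets of [sierpinski] are the empty set, the closed point and the whole space. *)
  apply/continuous_closedP => D cD.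
  have [Do|nDo] := pselect (D open_pt).
    rewrite (_ : _ @^-1` _ = setT); first exact: closedT.
    rewrite -subTset => b' _ /=; case: ifP => // _.
    by apply: cD => U /sierpinski_specializes[_ [-> Uo]]; exists open_pt.
  have [Dc|nDc] := pselect (D closed_pt).
    rewrite (_ : _ @^-1` _ = closure (range f)); first exact: closed_closure.
    by apply/seteqP; split=> b' /=; [case: ifP => // /asboolP|move/asboolP ->].
  rewrite (_ : _ @^-1` _ = set0); first exact: closed0.
  by rewrite -subset0 => b' /=; case: ifP.
have [a|h [_ hs]] := fP _ _ _ calP_closed_pt_incl
  (cst tt : continuousType A one_point) (mkcts cs : continuousType B _).
  by rewrite /= /mkcts asboolT //; apply: subset_closure; exists a.
by have := hs b; rewrite /= /mkcts; case: ifP => // /asboolP.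
Qed.

(** Let [t] send [F1] and [F2] to the two closed points and the rest to the open point. If [h]
    extends [t] along [f], the preimages of the closed points under [h] are disjoint closed sets
    containing the two images. *)
Lemma left_orth_calP_separated (A B : topologicalType) (f : continuousType A B)
    (F1 F2 : set A) :
  left_orth calP f -> closed F1 -> closed F2 -> F1 `&` F2 = set0 ->
  closure (f @` F1) `&` closure (f @` F2) = set0.
Proof.
move=> fP cF1 cF2 F12.
pose t a : two_closed_points :=
  if `[< F1 a >] then Some true else if `[< F2 a >] then Some false else None.
have t1 a : F1 a -> t a = Some true by move=> F1a; rewrite /t asboolT.
have t2 a : F2 a -> t a = Some false.
  move=> F2a; rewrite /t (asboolT F2a) asboolF // => F1a.
  by have : set0 a by rewrite -F12.
have tF a c : t a = Some c -> if c then F1 a else F2 a.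
  by rewrite /t; case: asboolP => [? [<-]//|_]; case: asboolP => [? [<-]|].
have ct : continuous t.
  apply/continuous_closedP => D cD.
  (* A closed set containing the open point is everything; any other has a union of some of [F1],
     [F2] as preimage. *)
  have [DN|nDN] := pselect (D None).
    rewrite (_ : _ @^-1` _ = setT); first exact: closedT.
    rewrite -subTset => a _ /=; apply: contrapT => nDa.
    move: cD; rewrite -openC open_two_closed_pointsE => cD.
    case ta: (t a) nDa => [c|//] nDc; exact: cD nDc DN.
  rewrite (_ : _ @^-1` _ =
      (if `[< D (Some true) >] then F1 else set0) `|`
      (if `[< D (Some false) >] then F2 else set0)).
    by apply: closedU; case: ifP => // _; exact: closed0.
  apply/seteqP; split=> a /=.
    by case ta: (t a) => [[]|//] Da; rewrite (asboolT Da); [left|right];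
      exact: tF ta.
  case; case: asboolP => // Dc.
    by move=> /t1 ->.
  by move=> /t2 ->.
have [//|h [ht _]] := fP _ _ _ calP_two_closed_points
  (mkcts ct : continuousType _ two_closed_points)
  (cst tt : continuousType B one_point).
have sub c (F : set A) : (forall a, F a -> t a = Some c) ->
    closure (f @` F) `<=` h @^-1` [set Some c : two_closed_points].
  move=> Ft; rewrite closureE; apply: smallest_sub.
    apply: preimage_closed; last exact: closed_two_closed_points.
    by move=> x _; exact: cts_fun.
  by move=> _ [a Fa <-] /=; rewrite -[h _]/((h \o f) a) ht; exact: Ft.
rewrite -subset0 => b [/(sub true) h1 /(sub false) h2].
by have := h1 t1; rewrite /= (h2 t2).
Qed.

(** * Compactness as membership in [calP_lr] *)

Lemma compact_hausdorff_calP_lr (K : topologicalType) :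
  hausdorff_space K -> compact [set: K] -> calP_lr (to_point K).
Proof.
move=> hK cK A B f fP t s _.
have [|h ch ht] := Taimanov_extension (f := f) hK cK (@cts_fun _ _ t)
  (left_orth_calP_dense fP).
  by move=> F1 F2; exact: left_orth_calP_separated.
by exists (mkcts ch : continuousType B K); split=> // b /=; case: (s b).
Qed.

(** Over a point the image of any ultrafilter converges, so every ultrafilter on [K] has a limit. *)
Lemma calP_lr_compact (K : topologicalType) :
  calP_lr (to_point K) -> compact [set: K].
Proof.
move=> KP; rewrite compact_ultra => U UU _.
have [|x Ux _] := calP_lr_ultra (y := tt : one_point) KP UU.
  exact: cvg_cst.
by exists x.
Qed.

Theorem corollary4p4 :
  (forall K : topologicalType, hausdorff_space K ->
     (compact [set: K] <-> calP_lr (to_point K))) /\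
  (forall (X Y : topologicalType) (f : continuousType X Y),
     calP_lr f -> proper_map f).
Proof.
split=> [K hK|X Y f]; last exact: calP_lr_proper.
by split; [exact: compact_hausdorff_calP_lr|exact: calP_lr_compact].
Qed.
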